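(* For every integer $n\ge2$, all $f,g\in C[0,1]$ and all $x\in[0,1]$, $$|V_n^*(fg;x)-V_n^*(f;x)\cdot V_n^*(g;x)|\le\frac n{2(n+1)}\cdot osc_{V_n^*}(f)\cdot osc_{V_n^*}(g).$$
   Context: For $n\ge2$, $V_n^*:C[0,1]\to C[0,1]$ is the King-type operator $V_n^*(f;x)=\sum_{k=0}^n\binom nk(r_n^*(x))^k(1-r_n^*(x))^{n-k}f\left(\frac kn\right)$, where $r_n^*(x)=-\frac1{2(n-1)}+\sqrt{\frac n{n-1}x^2+\frac1{4(n-1)^2}}$ (one has $0\le r_n^*(x)\le1$ for $x\in[0,1]$). The oscillation is $osc_{V_n^*}(f):=\max\{|f(k/n)-f(l/n)|:0\le k<l\le n\}$, and similarly for $g$. *)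

(* Defs.v *)
From mathcomp Require Import all_boot all_order all_algebra.
From mathcomp Require Import all_classical all_reals all_analysis.

Set Implicit Arguments.
Unset Strict Implicit.
Unset Printing Implicit Defensive.

Import Order.TTheory GRing.Theory Num.Theory.
Import numFieldNormedType.Exports.

Local Open Scope classical_set_scope.
Local Open Scope ring_scope.

(* Functions in C[0,1] are total functions f : R -> R with
   {within `[0, 1], continuous f}; the operators and oscillations below only
   depend on the values of f on [0, 1]. *)

Definition king_r (R : realType) (n : nat) (x : R) : R :=
  - (1 / (2 * (n%:R - 1))) +
  Num.sqrt (n%:R / (n%:R - 1) * x ^+ 2 + 1 / (4 * (n%:R - 1) ^+ 2)).

Definition king_V (R : realType) (n : nat) (f : R -> R) (x : R) : R :=
  \sum_(0 <= k < n.+1)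
    'C(n, k)%:R * king_r n x ^+ k * (1 - king_r n x) ^+ (n - k) *
    f (k%:R / n%:R).

(* The default value 0 of the iterated maximum does not affect it: the family
   consists of nonnegative reals and is nonempty for n >= 1. *)
Definition king_osc (R : realType) (n : nat) (f : R -> R) : R :=
  \big[Num.max/0]_(0 <= k < n.+1) \big[Num.max/0]_(k.+1 <= l < n.+1)
    `|f (k%:R / n%:R) - f (l%:R / n%:R)|.

(* Main.v *)
(** With [p_k] the binomial weights of [V_n*], the covariance equals
    [1/2 \sum_(k, l) p_k p_l (f_k - f_l) (g_k - g_l)].  The diagonal terms
    vanish, so it is at most [(1 - \sum_k p_k ^ 2) / 2] times the product of the
    oscillations, and Cauchy-Schwarz gives [\sum_k p_k ^ 2 >= 1 / (n + 1)]. *)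
Require Import Defs.
From mathcomp Require Import all_boot all_order all_algebra.
From mathcomp Require Import all_classical all_reals all_analysis.
From mathcomp Require Import ring lra.
Import Order.TTheory GRing.Theory Num.Theory.
Import numFieldNormedType.Exports.

Local Open Scope classical_set_scope.
Local Open Scope ring_scope.

(** Expanding [(f i - f j) * (g i - g j)] gives four double sums; each factors, and [p1] turns the
    two unmixed ones into [\sum_i p i * (f i * g i)]. *)
Lemma weighted_covariance_double_sum (R : comNzRingType) (I : finType)
    (p f g : I -> R) (p1 : \sum_i p i = 1) :
  2 * (\sum_i p i * (f i * g i) - (\sum_i p i * f i) * (\sum_i p i * g i)) =
  \sum_i \sum_j p i * p j * ((f i - f j) * (g i - g j)).
Proof.
transitivity (\sum_i \sum_j ((p i * (f i * g i)) * p j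
    + p i * (p j * (f j * g j)) - (p i * f i) * (p j * g j)
    - (p i * g i) * (p j * f j))); last first.
  by apply: eq_bigr => i _; apply: eq_bigr => j _; ring.
under [RHS]eq_bigr => i _ do rewrite !sumrB big_split /= -!mulr_sumr p1.
by rewrite !sumrB big_split /= -!mulr_suml p1; ring.
Qed.

(** With [c] the uniform weight, expanding [0 <= \sum_i (p i - c) ^+ 2] leaves
    [\sum_i p i ^+ 2 - 2 * c + c]. *)
Lemma sum_sqr_weights_ge (R : realFieldType) (I : finType) (p : I -> R)
    (p1 : \sum_i p i = 1) : #|I|%:R^-1 <= \sum_i p i ^+ 2.
Proof.
have N0 : #|I|%:R != 0 :> R.
  rewrite pnatr_eq0; apply/eqP => /card0_eq I0; move/eqP: p1.
  by rewrite big_pred0 // eq_sym oner_eq0.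
set c := #|I|%:R^-1.
have : 0 <= \sum_i (p i - c) ^+ 2 by apply: sumr_ge0 => i _; apply: sqr_ge0.
have -> : \sum_i (p i - c) ^+ 2 = \sum_i (p i ^+ 2 - p i * (2 * c) + c ^+ 2).
  by apply: eq_bigr => i _; ring.
rewrite big_split sumrB /= -mulr_suml p1 sumr_const -[_ *+ #|_|]mulr_natr.
have -> : c ^+ 2 * #|I|%:R = c by rewrite /c; field.
by move=> h; lra.
Qed.

Lemma weighted_covariance_le (R : realFieldType) (I : finType)
    (p f g : I -> R) (A B : R) (p0 : forall i, 0 <= p i)
    (p1 : \sum_i p i = 1) (fA : forall i j, `|f i - f j| <= A)
    (gB : forall i j, `|g i - g j| <= B) :
  `|\sum_i p i * (f i * g i) - (\sum_i p i * f i) * (\sum_i p i * g i)|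
    <= (1 - #|I|%:R^-1) / 2 * (A * B).
Proof.
(* An index exists because the weights sum to 1; taking [i = j] in [fA] and [gB] shows that both
   bounds are nonnegative. *)
have AB0 : 0 <= A * B.
  case: (pickP I) => [i _|I0].
    by apply: mulr_ge0; [apply: le_trans (fA i i)|apply: le_trans (gB i i)].
  by move/eqP: p1; rewrite big_pred0 // eq_sym oner_eq0.
suff h : `|2 * (\sum_i p i * (f i * g i)
    - (\sum_i p i * f i) * (\sum_i p i * g i))|
    <= A * B * (1 - \sum_i p i ^+ 2).
  have := ler_wpM2l AB0 (@sum_sqr_weights_ge _ _ _ p1).
  by move: h; rewrite normrM ger0_norm //; lra.
rewrite (@weighted_covariance_double_sum _ _ _ f g p1).
(* The term [*+ (j == i)] removes the diagonal weights, where the differences vanish; this is what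
   produces [1 - \sum_i p i ^+ 2] instead of 1. *)
apply: (@le_trans _ _
    (\sum_i \sum_j (p i * p j - (p i * p j) *+ (j == i)) * (A * B))).
  apply: le_trans (ler_norm_sum _ _ _) _; apply: ler_sum => i _.
  apply: le_trans (ler_norm_sum _ _ _) _; apply: ler_sum => j _.
  have [->|_] := eqVneq j i; first by rewrite !subrr !mulr0 normr0 mul0r.
  rewrite mulr0n subr0 normrM ger0_norm ?mulr_ge0 // ler_wpM2l ?mulr_ge0 //.
  by rewrite normrM ler_pM.
under eq_bigr => i _.
  rewrite -mulr_suml sumrB -mulr_sumr p1 mulr1 (bigD1 i) //= eqxx mulr1n.
  rewrite [\sum_(_ | _) _]big1 ?addr0 -?expr2; last by move=> j /negbTE ->.
  over.
by rewrite -mulr_suml sumrB p1 mulrC.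
Qed.

(** With [a = 1 / (2 * (n - 1))] one has [n / (n - 1) = 1 + 2 * a], so the radicand is
    [(1 + 2 * a) * x ^+ 2 + a ^+ 2], which lies between [a ^+ 2] and [(1 + a) ^+ 2]. *)
Lemma king_r_bounds (R : realType) (n : nat) (hn : (2 <= n)%N) (x : R)
    (hx : x \in `[0, 1]) : 0 <= king_r n x <= 1.
Proof.
move: hx; rewrite in_itv /= => /andP[x0 x1].
have n2 : 2 <= n%:R :> R by rewrite ler_nat.
have m0 : 1 <= n%:R - 1 :> R by lra.
rewrite /king_r; set a := 1 / (2 * (n%:R - 1)).
have a0 : 0 <= a by rewrite divr_ge0 //; lra.
have mN0 : n%:R - 1 != 0 :> R by apply/eqP; lra.
have -> : n%:R / (n%:R - 1) * x ^+ 2 + 1 / (4 * (n%:R - 1) ^+ 2) =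
    (1 + 2 * a) * x ^+ 2 + a ^+ 2 by rewrite /a; field.
have x2 : 0 <= x ^+ 2 <= 1 by rewrite sqr_ge0 expr_le1.
have ax2 : 0 <= (1 + 2 * a) * x ^+ 2 <= 1 + 2 * a.
  by apply/andP; split; nra.
case/andP: ax2 => ax0 ax1; apply/andP; split.
  by rewrite addrC subr_ge0 -{1}(ger0_norm a0) -sqrtr_sqr ler_wsqrtr // lerDr.
rewrite addrC lerBlDr -(ger0_norm (addr_ge0 ler01 a0)) -sqrtr_sqr.
by apply: ler_wsqrtr; rewrite sqrrD; lra.
Qed.

(** The maximum runs over [k < l] only; symmetry handles [j < i], and the default value 0 handles
    [i = j]. *)
Lemma king_osc_ge (R : realType) (n : nat) (f : R -> R) (i j : 'I_n.+1) :
  `|f (i%:R / n%:R) - f (j%:R / n%:R)| <= king_osc n f.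
Proof.
have lt_case (k l : 'I_n.+1) : (k < l)%N ->
    `|f (k%:R / n%:R) - f (l%:R / n%:R)| <= king_osc n f.
  move=> kl; pose F (i j : nat) := `|f (i%:R / n%:R) - f (j%:R / n%:R)|.
  pose M (i : nat) := \big[Num.max/0]_(i.+1 <= j < n.+1) F i j.
  apply: (@le_trans _ _ (M k)).
    apply: (le_bigmax_seq 0 (l : nat) xpredT (F k)) => //.
    by rewrite mem_index_iota kl ltn_ord.
  apply: (le_bigmax_seq 0 (k : nat) xpredT M) => //.
  by rewrite mem_index_iota ltn_ord.
have [ij|ji|/val_inj->] := ltngtP i j; first exact: lt_case.
  by rewrite distrC; apply: lt_case.
by rewrite subrr normr0; apply: bigmax_ge_id.
Qed.

Theorem theorem9p9 (R : realType) (n : nat) (hn : (2 <= n)%N)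
    (f g : R -> R)
    (hf : {within `[0, 1], continuous f})
    (hg : {within `[0, 1], continuous g})
    (x : R) (hx : x \in `[0, 1]) :
  `|king_V n (fun t => f t * g t) x - king_V n f x * king_V n g x|
    <= n%:R / (2 * (n%:R + 1)) * king_osc n f * king_osc n g.
Proof.
have /andP[r0 r1] := @king_r_bounds _ _ hn _ hx.
rewrite /king_V !big_mkord; set r := king_r n x in r0 r1 *.
pose p (k : 'I_n.+1) : R := 'C(n, k)%:R * r ^+ k * (1 - r) ^+ (n - k).
have p0 k : 0 <= p k by rewrite !mulr_ge0 ?exprn_ge0 ?subr_ge0.
have p1 : \sum_k p k = 1.
  (* Binomial theorem for [1 = ((1 - r) + r) ^+ n]. *)
  rewrite -(expr1n R n) -[X in X ^+ n](subrK r) exprDn.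
  by apply: eq_bigr => k _; rewrite /p -mulr_natl; ring.
have := @weighted_covariance_le _ _ p _ _ _ _ p0 p1 (@king_osc_ge _ n f)
  (@king_osc_ge _ n g).
rewrite card_ord -[n.+1%:R]natr1.
have nN0 : n%:R + 1 != 0 :> R by rewrite natr1 pnatr_eq0.
(* There are [n + 1] nodes, which yields the stated constant. *)
suff -> : n%:R / (2 * (n%:R + 1)) = (1 - (n%:R + 1)^-1) / 2 :> R.
  by rewrite -[_ / 2 * _ * _]mulrA.
by field.
Qed.
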